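(* Let $\mathbf{R}$ be a real closed field, let $a, b \in \mathbf{R}$ with $a < b$ and let $P, Q \in \mathbf{R}[X] \setminus \{0\}$ with $\deg P = p \ge 1$ and $\deg Q = q < p$. With $s$, $d_i$, $T_i$, $t_i$, $\mathrm{p}(i)$ and $\epsilon_n$ associated to $P$ and $Q$ as in the context, $$ \mathrm{Ind}_a^b\Big(\frac{Q}{P}\Big) = \frac{1}{2}\sum_{0 \le i \le s-1} \epsilon_{d_{\mathrm{p}(i) - 1} - d_i}\cdot \mathrm{sign}(t_{\mathrm{p}(i)}) \cdot \mathrm{sign}(t_i) \cdot \left( \mathrm{sign}\Big( \frac{T_{i+1}}{T_{i}}, b \Big) - \mathrm{sign}\Big( \frac{T_{i+1}}{T_{i}}, a \Big) \right). $$
   Context: $\mathbf{R}$ is a real closed field; $\mathrm{sign}(y)\in\{-1,0,1\}$ is the sign of $y \in \mathbf{R}$. **Cauchy index.** Let $x\in\mathbf{R}$ and $F,G\in\mathbf{R}[X]\setminus\{0\}$. Write uniquely $\frac{G}{F} = (X-x)^m \frac{\widetilde G}{\widetilde F}$ with $m\in\mathbb{Z}$, $\widetilde F$ monic, $\widetilde F,\widetilde G \in \mathbf{R}[X]$ coprime, $\widetilde F(x)\neq 0$, $\widetilde G(x)\ne 0$. If $m<0$, set $\mathrm{Ind}_x^+(\frac GF)=\frac12\mathrm{sign}\big(\frac{\widetilde G(x)}{\widetilde F(x)}\big)$ and $\mathrm{Ind}_x^-(\frac GF)=\frac12(-1)^m\mathrm{sign}\big(\frac{\widetilde G(x)}{\widetilde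 F(x)}\big)$; if $m\ge 0$, both are $0$. Set $\mathrm{Ind}_x(\frac GF)=\mathrm{Ind}_x^+(\frac GF)-\mathrm{Ind}_x^-(\frac GF)$. For $a<b$ in $\mathbf{R}$, $$\mathrm{Ind}_a^b\Big(\frac GF\Big)=\mathrm{Ind}_a^+\Big(\frac GF\Big)+\sum_{x\in(a,b)}\mathrm{Ind}_x\Big(\frac GF\Big)-\mathrm{Ind}_b^-\Big(\frac GF\Big)$$ (only the finitely many roots of $F$ in $(a,b)$ contribute). **Sign of a rational function at a point.** With the same notation, $\mathrm{sign}(\frac GF,x)=\mathrm{sign}(\widetilde G(x)\widetilde F(x))\in\{-1,1\}$ if $m=0$, and $\mathrm{sign}(\frac GF,x)=0$ if $m\neq0$. **Sturm sequence.** For $P,Q\in\mathbf{R}[X]\setminus\{0\}$: $S_0=P$, $S_1=Q$, $S_{i+1}=-\mathrm{Rem}(S_{i-1},S_i)$ (remainder of the Euclidean division of $S_{i-1}$ by $S_i$), and $s$ is the index such that $S_1,\dots,S_s\neq0$ and $S_{s+1}=0$. Let $d_i=\deg S_i$ for $0\le i\le s$ and $d_{-1}=p+1$ (so $d_0=p$, $d_1=q$). **Subresultants.** Let $\deg P=p\ge1$, $\deg Q=q<p$. For $0\le j\le q$, $\mathrm{sResP}_j(P,Q)\in\mathbf{R}[X]$ is the determinant of the $(p+q-2j)\times(p+q-2j)$ matrix whose rows correspond, from top to bottom, to the polynomials $X^{q-j-1}P,\dots,XP,P,Q,XQ,\dots,X^{p-j-1}Q$ (in this order); in each row the first $p+q-2j-1$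 entries are the coefficients of $X^{p+q-j-1},X^{p+q-j-2},\dots,X^{j+1}$ in the corresponding polynomial, and the last entry is the polynomial itself. By convention $\mathrm{sResP}_p(P,Q)=P$, $\mathrm{sResP}_{p-1}(P,Q)=Q$, and $\mathrm{sResP}_j(P,Q)=0$ for $q<j<p-1$. Set $T_0=P$, $t_0=1$ (even if $P$ is not monic), and for $1\le i\le s$, $T_i=\mathrm{sResP}_{d_{i-1}-1}(P,Q)$ and $t_i=$ the leading coefficient of $T_i$. (So $T_1=Q$; by the known Structure Theorem of Subresultants, each $T_i$ is nonzero of degree $d_i$.) **Further notation.** For $n\in\mathbb{Z}$, $\epsilon_n=(-1)^{\frac12 n(n-1)}$. For $0\le i\le s$, $\mathrm{p}(i)=\max\{j \mid 0\le j\le i,\ d_{j-1}-d_j \text{ is odd}\}$ (well defined since $d_{-1}-d_0=1$). *)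

(* Defs.v *)
From mathcomp Require Import all_boot all_order all_algebra.
From mathcomp Require Import ring polyrcf.
Set Implicit Arguments.
Unset Strict Implicit.
Unset Printing Implicit Defensive.
Import Order.TTheory GRing.Theory Num.Theory.
Local Open Scope ring_scope.

(* The decomposition G / F = (X - x)^m (Gt / Ft) in the field of rational     *)
(* functions, with Ft monic, Ft and Gt coprime, and Ft(x), Gt(x) nonzero.     *)
Definition is_decomp (R : fieldType) (x : R) (G F : {poly R})
    (m : int) (Gt Ft : {poly R}) : Prop :=
  [/\ tofrac G / tofrac F
        = tofrac ('X - x%:P) ^ m * (tofrac Gt / tofrac Ft),
      Ft \is monic, coprimep Ft Gt, Ft.[x] != 0 & Gt.[x] != 0].

(* H with all its factors X - x removed.                                      *)
Definition unroot (R : fieldType) (x : R) (H : {poly R}) : {poly R} :=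
  H %/ ('X - x%:P) ^+ mup x H.

(* The three components of the decomposition of G / F at x; decompP and       *)
(* decomp_uniq below show that, for F and G nonzero, they are the only triple *)
(* satisfying is_decomp.                                                      *)
Definition decomp_exp (R : fieldType) (x : R) (G F : {poly R}) : int :=
  (mup x G)%:Z - (mup x F)%:Z.

Definition decomp_den (R : fieldType) (x : R) (G F : {poly R}) : {poly R} :=
  let D := unroot x (F %/ gcdp F G) in (lead_coef D)^-1 *: D.

Definition decomp_num (R : fieldType) (x : R) (G F : {poly R}) : {poly R} :=
  (lead_coef (unroot x (F %/ gcdp F G)))^-1 *: unroot x (G %/ gcdp F G).

Lemma unrootE (R : fieldType) (x : R) (H : {poly R}) :
  H != 0 -> H = unroot x H * ('X - x%:P) ^+ mup x H.
Proof. by move=> nz; rewrite /unroot divpK // -mup_geq. Qed.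

Lemma unroot_neq0 (R : fieldType) (x : R) (H : {poly R}) :
  H != 0 -> (unroot x H).[x] != 0.
Proof.
move=> nz; have nzu : unroot x H != 0.
  by apply: contraNneq (nz) => u0; rewrite (unrootE x nz) u0 mul0r.
have := congr1 (mup x) (unrootE x nz).
rewrite mupM // ?expf_neq0 ?polyXsubC_eq0 // mup_XsubCX eqxx.
move/eqP; rewrite -[X in X == _]add0n eqn_add2r => /eqP m0.
by move: (XsubC_dvd x nzu); rewrite -m0 dvdp_XsubCl => /negbT; rewrite rootE.
Qed.

Lemma ratio_decomp (K : fieldType) (a b c u v w : K) :
  a != 0 -> b != 0 -> u != 0 -> v != 0 ->
  c * w * a / (b * v * a) = w / v * (u * c / (u * b)).
Proof. by move=> na nb nu nv; field; rewrite nu nv nb na. Qed.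

Lemma decompP (R : fieldType) (x : R) (G F : {poly R}) : F != 0 -> G != 0 ->
  is_decomp x G F (decomp_exp x G F) (decomp_num x G F) (decomp_den x G F).
Proof.
move=> nF nG; rewrite /is_decomp /decomp_den /decomp_num /decomp_exp.
set D := gcdp F G; set F1 := F %/ D; set G1 := G %/ D.
have nD : D != 0 by rewrite gcdp_eq0 negb_and nF.
have eF : F = F1 * D by rewrite divpK // dvdp_gcdl.
have eG : G = G1 * D by rewrite divpK // dvdp_gcdr.
have nF1 : F1 != 0 by apply: contraNneq (nF) => e; rewrite eF e mul0r.
have nG1 : G1 != 0 by apply: contraNneq (nG) => e; rewrite eG e mul0r.
have cop : coprimep F1 G1 by rewrite coprimep_div_gcd // nF.
have uF := unrootE x nF1; have uG := unrootE x nG1.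
have vF := unroot_neq0 x nF1; have vG := unroot_neq0 x nG1.
move: (unroot x F1) (unroot x G1) uF uG vF vG => f g uF uG vF vG.
have nf : f != 0 by apply: contraNneq (vF) => ->; rewrite horner0.
have nl : (lead_coef f)^-1 != 0 by rewrite invr_eq0 lead_coef_eq0.
split; last 4 first.
- by rewrite monicE lead_coefZ mulVf // lead_coef_eq0.
- rewrite coprimepZl // coprimepZr //.
  have df : f %| F1 by rewrite uF dvdp_mulr.
  have dg : g %| G1 by rewrite uG dvdp_mulr.
  exact: coprimep_dvdl dg (coprimep_dvdr df cop).
- by rewrite hornerZ mulf_neq0.
- by rewrite hornerZ mulf_neq0.
have nT (H : {poly R}) : H != 0 -> tofrac H != 0 by rewrite tofrac_eq0.
have nX : tofrac ('X - x%:P) != 0 by rewrite nT // polyXsubC_eq0.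
have -> : (mup x G)%:Z - (mup x F)%:Z = (mup x G1)%:Z - (mup x F1)%:Z.
  rewrite eG eF !mupM //.
  by rewrite !PoszD opprD addrACA subrr addr0.
move: (mup x G1) (mup x F1) uF uG => k l uF uG.
rewrite expfzDr // -exprnN -exprnP eG eF uG uF -!mul_polyC !tofracM !tofracXn.
have nc : tofrac (lead_coef f)^-1%:P != 0 by rewrite nT // polyC_eq0.
have nl' := expf_neq0 l nX; have := nT _ nD; have := nT _ nf.
move: (tofrac D) (tofrac f) (tofrac g) nc nl' => a b c nc nl' nb na.
move: (tofrac _%:P) (tofrac _ ^+ l) (tofrac _ ^+ k) nc nl' => u v w nu nv.
exact (ratio_decomp c w na nb nu nv).
Qed.

Lemma ratio_cancel (K : fieldType) (y g f g' f' : K) (m : int) (n : nat) :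
  y != 0 -> f != 0 -> f' != 0 ->
  y ^ m * (g / f) = y ^ (m + n%:Z) * (g' / f') -> g * f' = y ^+ n * g' * f.
Proof.
move=> ny nf nf'; rewrite expfzDr // -mulrA => /(mulfI (expfz_neq0 m ny)) e.
by rewrite -[g](mulfVK nf) e -exprnP; field.
Qed.

Lemma decomp_uniq (R : fieldType) (x : R) (G F Gt Ft Gt' Ft' : {poly R})
    (m m' : int) :
  is_decomp x G F m Gt Ft -> is_decomp x G F m' Gt' Ft' ->
  [/\ m = m', Gt = Gt' & Ft = Ft'].
Proof.
wlog le_mm' : m m' Gt Ft Gt' Ft' / m <= m' => [hw|].
  by case/orP: (le_total m m') => le d d'; first exact: hw;
     case: (hw _ _ _ _ _ _ le d' d) => -> -> ->.
case=> e0 mF cF vF vG [e mF' cF' vF' vG']; rewrite e0 in e.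
have nT (H : {poly R}) : H != 0 -> tofrac H != 0 by rewrite tofrac_eq0.
have nX : tofrac ('X - x%:P) != 0 by rewrite nT // polyXsubC_eq0.
have nF := nT _ (monic_neq0 mF); have nF' := nT _ (monic_neq0 mF').
have [n em'] : exists n : nat, m' = m + n%:Z.
  by exists `|m' - m|%N; rewrite gez0_abs ?subr_ge0 // [RHS]addrC subrK.
have {e} e : Gt * Ft' = ('X - x%:P) ^+ n * Gt' * Ft.
  apply/eqP; rewrite -tofrac_eq !tofracM tofracXn; apply/eqP.
  move: (tofrac ('X - x%:P)) (tofrac Gt) (tofrac Ft) (tofrac Gt') (tofrac Ft') nX nF nF' e.
  by move=> y g f g' f' ny nf nf'; rewrite em'; exact (ratio_cancel ny nf nf').
case: n => [|n] in em' e *; last first.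
  have := congr1 (horner^~ x) e.
  rewrite !hornerE subrr expr0n !mul0r => /eqP.
  by rewrite mulf_eq0 (negPf vG) (negPf vF').
rewrite addr0 in em'; rewrite mul1r in e.
have eF : Ft = Ft'.
  apply/eqP; rewrite -eqp_monic // /eqp; apply/andP; split.
    by rewrite -(Gauss_dvdpr _ cF) e dvdp_mull.
  by rewrite -(Gauss_dvdpr _ cF') -e dvdp_mull.
by split=> //; apply: (mulIf (monic_neq0 mF')); rewrite e eF.
Qed.

(* The indices are half-integers, seen in R.  In all the definitions below    *)
(* the rational function G / F is given by the pair G, F, in this order.      *)
Definition ind_plus (R : rcfType) (x : R) (G F : {poly R}) : R :=
  if decomp_exp x G F < 0
  then 2^-1 * Num.sg ((decomp_num x G F).[x] / (decomp_den x G F).[x])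
  else 0.

Definition ind_minus (R : rcfType) (x : R) (G F : {poly R}) : R :=
  if decomp_exp x G F < 0
  then 2^-1 * (-1) ^ decomp_exp x G F
         * Num.sg ((decomp_num x G F).[x] / (decomp_den x G F).[x])
  else 0.

Definition ind (R : rcfType) (x : R) (G F : {poly R}) : R :=
  ind_plus x G F - ind_minus x G F.

Lemma indNroot (R : rcfType) (x : R) (G F : {poly R}) :
  ~~ root F x -> ind x G F = 0.
Proof.
move=> Fx; rewrite /ind /ind_plus /ind_minus /decomp_exp (mupNroot Fx).
by rewrite ltNge subr_ge0 lez_nat leq0n subr0.
Qed.

(* roots F a b is the duplicate-free list of the roots of F in the open       *)
(* interval (a, b), for F != 0; the other points contribute 0 (indNroot).     *)
Definition cauchy_index (R : rcfType) (a b : R) (G F : {poly R}) : R :=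
  ind_plus a G F + \sum_(x <- roots F a b) ind x G F - ind_minus b G F.

Definition sign_ratio (R : rcfType) (G F : {poly R}) (x : R) : R :=
  if decomp_exp x G F == 0
  then Num.sg ((decomp_num x G F).[x] * (decomp_den x G F).[x])
  else 0.

Definition deg (R : fieldType) (H : {poly R}) : nat := (size H).-1.

Fixpoint sturm_pair (R : fieldType) (P Q : {poly R}) (i : nat) :
    {poly R} * {poly R} :=
  if i is i'.+1 then
    let: (A, B) := sturm_pair P Q i' in (B, - (A %% B))
  else (P, Q).

Definition sturm (R : fieldType) (P Q : {poly R}) (i : nat) : {poly R} :=
  (sturm_pair P Q i).1.

Lemma sturm0 (R : fieldType) (P Q : {poly R}) : sturm P Q 0 = P.
Proof. by []. Qed.

Lemma sturm1 (R : fieldType) (P Q : {poly R}) : sturm P Q 1 = Q.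
Proof. by []. Qed.

Lemma sturmS (R : fieldType) (P Q : {poly R}) (i : nat) :
  sturm P Q i.+2 = - (sturm P Q i %% sturm P Q i.+1).
Proof. by rewrite /sturm /=; case: (sturm_pair P Q i). Qed.

Lemma sturm_ends (R : fieldType) (P Q : {poly R}) :
  exists i, sturm P Q i.+1 == 0.
Proof.
suff H n : (exists i, sturm P Q i.+1 == 0) \/ (size (sturm P Q n.+1) + n <= size Q)%N.
  case: (H (size Q).+1) => // /(leq_trans (leq_addl _ _)).
  by rewrite ltnn.
elim: n => [|n [IH|IH]]; [by right; rewrite addn0 | by left |].
case: (eqVneq (sturm P Q n.+1) 0) => [e|nz]; first by left; exists n; apply/eqP.
right; rewrite addnS (leq_trans _ IH) // -addSn leq_add2r.
by rewrite sturmS size_polyN ltn_modp.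
Qed.

(* The index s: sturm P Q i is nonzero for 1 <= i <= s, and 0 for i = s + 1.  *)
Definition sturm_len (R : fieldType) (P Q : {poly R}) : nat :=
  ex_minn (sturm_ends P Q).

Definition sturm_deg (R : fieldType) (P Q : {poly R}) (i : nat) : nat :=
  deg (sturm P Q i).

(* d_(i-1), for 0 <= i, with d_(-1) = p + 1.                                  *)
Definition sturm_deg_pred (R : fieldType) (P Q : {poly R}) (i : nat) : nat :=
  if i is i'.+1 then sturm_deg P Q i' else (deg P).+1.

(* Rows X^(q-j-1) P, ..., P, Q, ..., X^(p-j-1) Q, numbered from 0.            *)
Definition sres_row (R : fieldType) (P Q : {poly R}) (j i : nat) : {poly R} :=
  if (i < deg Q - j)%N then 'X^(deg Q - j - 1 - i) * P
  else 'X^(i - (deg Q - j)) * Q.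

Definition sres_mx (R : fieldType) (P Q : {poly R}) (j : nat) :
    'M[{poly R}]_(deg P + deg Q - j.*2) :=
  \matrix_(i, k)
    if (k < deg P + deg Q - j.*2 - 1)%N
    then ((sres_row P Q j i)`_(deg P + deg Q - j - 1 - k))%:P
    else sres_row P Q j i.

(* For j = deg Q = deg P - 1 the determinant is Q, in accordance with the     *)
(* convention for j = deg P - 1.                                              *)
Definition sresP (R : fieldType) (P Q : {poly R}) (j : nat) : {poly R} :=
  if (j <= deg Q)%N then \det (sres_mx P Q j)
  else if j == deg P then P
  else if j == (deg P).-1 then Q
  else 0.

Definition sresT (R : fieldType) (P Q : {poly R}) (i : nat) : {poly R} :=
  if i is i'.+1 then sresP P Q (sturm_deg P Q i' - 1) else P.

Definition srest (R : fieldType) (P Q : {poly R}) (i : nat) : R :=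
  if i is _.+1 then lead_coef (sresT P Q i) else 1.

Definition eps (R : fieldType) (n : int) : R :=
  (-1) ^ ((n * (n - 1)) %/ 2)%Z.

(* The largest j <= i such that d_(j-1) - d_j is odd.  Here `|m - n|%N is the *)
(* distance between m and n, so that the parity is that of the integer m - n. *)
Definition odd_index (R : fieldType) (P Q : {poly R}) (i : nat) : nat :=
  \max_(j < i.+1 | odd `|sturm_deg_pred P Q j - sturm_deg P Q j|%N) j.

(* Main.v *)
Require Import Defs.
From mathcomp Require Import all_boot all_order all_algebra all_fingroup.
From mathcomp Require Import ring zify polyorder polyrcf.
Set Implicit Arguments.
Unset Strict Implicit.
Unset Printing Implicit Defensive.
Import Order.TTheory GRing.Theory Num.Theory.
Local Open Scope ring_scope.

(** The Sturm sequence S_i computes the Cauchy index, and the subresultants T_i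
    are scalar multiples c_i S_i of it; only the signs of the c_i matter.

    Cauchy index.  Near a point x, a rational function G / F has a constant sign
    e+ on the right of x and a constant sign e- on its left.  A pole of G / F is
    a zero of F / G, so at every x exactly one of the following holds: G / F has
    a pole, F / G has a pole, or both are finite and nonzero at x.  Hence the
    right indices of G / F and F / G add up to (e+ - sign(G / F, x)) / 2, and
    the left ones to (e- - sign(G / F, x)) / 2 ([ind_plus_inv],
    [ind_minus_inv]).  The right sign at a zero or pole is the left sign at the
    next one, so the sum of these over [a, b] telescopes ([sum_sign_jumps]):
    Ind (G / F) + Ind (F / G) = (sign(G / F, b) - sign(G / F, a)) / 2
    ([cauchy_index_inv]).  Since F / G and (F mod G) / G differ by a polynomial,
    they have the same index ([cauchy_index_mod]).  Running the signed Euclidean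
    algorithm gives the formula with S_i in place of T_i and without the sign
    factors ([cauchy_index_sturm]).

    Subresultants.  Row operations replace P by P mod Q in the Sylvester-type
    determinant of P and Q; reversing the rows exchanges the two blocks, and the
    leading rows, which become triangular, split off as powers of the leading
    coefficient of Q ([sylv_det_step]).  Iterating, T_i = c_i S_i with c_i an
    explicit product of signs and of powers of the leading coefficients l_k of
    the S_k ([sresT_sturm]).  With d the degree drop between S_i and S_(i+1),
    almost all factors of c_(i+1) c_(i+2) are squares, and its sign is
    (-1)^(d (d - 1) / 2) times the sign of (l_i l_(i+1))^(d + 1), where l_0
    stands for 1 ([sres_coef_mul]).  The sign of l_i l_(i+1) thus enters exactly
    when d is even, which is why the formula refers to the last index with an
    odd drop: [sres_sign] shows by induction that its coefficient is the sign of
    c_i c_(i+1).  Multiplying by the same factor in sign(T_(i+1) / T_i) leaves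
    sign(S_(i+1) / S_i). *)

(** * Local indices in terms of multiplicities and right signs *)

Lemma mup_mu (R : rcfType) (x : R) (H : {poly R}) : H != 0 -> mup x H = \mu_x H.
Proof.
move=> nH; apply/eqP; rewrite eqn_leq -root_le_mu // -mup_geq // leqnn.
by rewrite mup_geq // root_le_mu // leqnn.
Qed.

(** The factor X - x is positive on the right of x, so removing it does not
    change the right sign. *)
Lemma sgr_unroot (R : rcfType) (x : R) (H : {poly R}) :
  H != 0 -> Num.sg (unroot x H).[x] = sgp_right H x.
Proof.
move=> nH; rewrite -[in RHS](divpK (root_mu H x)) -mup_mu // -/(unroot x H).
have -> : sgp_right (unroot x H * ('X - x%:P) ^+ mup x H) x
        = sgp_right (unroot x H) x.
  elim: (mup x H) => [|n IHn]; first by rewrite mulr1.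
  rewrite exprSr mulrA sgp_right_mul IHn -[in RHS](mulr1 (sgp_right _ _)).
  congr (_ * _); rewrite sgp_right_rec polyXsubC_eq0 root_XsubC eqxx /=.
  by rewrite derivXsubC sgp_rightc sgr1.
by rewrite sgp_rightNroot // rootE unroot_neq0.
Qed.

(** Cancelling the gcd and making the denominator monic only change the product
    G * F by square factors, so all the local data of G / F can be read off the
    multiplicities and the right sign of G * F. *)
Lemma sgr_decomp (R : rcfType) (x : R) (G F : {poly R}) : F != 0 -> G != 0 ->
  Num.sg ((decomp_num x G F).[x] * (decomp_den x G F).[x])
  = sgp_right (G * F) x.
Proof.
move=> nF nG; rewrite /decomp_num /decomp_den !hornerZ.
set D := gcdp F G.
have nD : D != 0 by rewrite gcdp_eq0 negb_and nF.
have eF : F = F %/ D * D by rewrite divpK // dvdp_gcdl.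
have eG : G = G %/ D * D by rewrite divpK // dvdp_gcdr.
have nF1 : F %/ D != 0 by apply: contraNneq (nF) => e; rewrite eF e mul0r.
have nG1 : G %/ D != 0 by apply: contraNneq (nG) => e; rewrite eG e mul0r.
rewrite [in RHS]eG [in RHS]eF !sgp_right_mul [RHS]mulrACA.
rewrite sgp_right_square // mulr1.
rewrite mulrACA sgrM -expr2 sgrX sqr_sg.
have nu : unroot x (F %/ D) != 0.
  by apply: contraNneq (unroot_neq0 x nF1) => ->; rewrite horner0.
by rewrite invr_eq0 lead_coef_eq0 nu mul1r sgrM !sgr_unroot.
Qed.

Lemma decomp_exp_mu (R : rcfType) (x : R) (G F : {poly R}) :
  F != 0 -> G != 0 -> decomp_exp x G F = (\mu_x G)%:Z - (\mu_x F)%:Z.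
Proof. by move=> nF nG; rewrite /decomp_exp !mup_mu. Qed.

(** The order condition appears as a factor 0 or 1, so that the indices of G / F
    and F / G can be added before the multiplicities are compared. *)
Lemma ind_plusE (R : rcfType) (x : R) (G F : {poly R}) : F != 0 -> G != 0 ->
  ind_plus x G F
  = 2^-1 * (sgp_right (G * F) x *+ (\mu_x G < \mu_x F)%N).
Proof.
move=> nF nG; rewrite /ind_plus decomp_exp_mu // subr_lt0 ltz_nat.
case: ifP => _; rewrite ?mulr0 // -sgr_decomp //.
by rewrite !sgrM sgrV.
Qed.

Lemma ind_minusE (R : rcfType) (x : R) (G F : {poly R}) : F != 0 -> G != 0 ->
  ind_minus x G F
  = 2^-1 * ((-1) ^+ \mu_x (G * F) * sgp_right (G * F) x
             *+ (\mu_x G < \mu_x F)%N).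
Proof.
move=> nF nG; rewrite /ind_minus decomp_exp_mu // subr_lt0 ltz_nat.
case: ifP => _; rewrite ?mulr0 // -sgr_decomp //.
rewrite mulr1n -mulrA !sgrM sgrV; congr (_ * (_ * _)).
rewrite mu_mul ?mulf_neq0 // expfzDr ?oppr_eq0 ?oner_eq0 //.
by rewrite exprD -invr_expz -!exprnP invr_sign.
Qed.

Lemma sign_ratioE (R : rcfType) (x : R) (G F : {poly R}) : F != 0 -> G != 0 ->
  sign_ratio G F x = sgp_right (G * F) x *+ (\mu_x G == \mu_x F).
Proof.
move=> nF nG; rewrite /sign_ratio decomp_exp_mu // subr_eq0 eqz_nat.
by case: ifP => _; rewrite ?sgr_decomp.
Qed.

Lemma decomp_num0 (R : rcfType) (x : R) (F : {poly R}) : decomp_num x 0 F = 0.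
Proof. by rewrite /decomp_num /unroot !div0p scaler0. Qed.

Lemma ind_plus0 (R : rcfType) (x : R) (F : {poly R}) : ind_plus x 0 F = 0.
Proof.
by rewrite /ind_plus decomp_num0 horner0 mul0r sgr0 mulr0; case: ifP.
Qed.

Lemma ind_minus0 (R : rcfType) (x : R) (F : {poly R}) : ind_minus x 0 F = 0.
Proof.
by rewrite /ind_minus decomp_num0 horner0 mul0r sgr0 !mulr0; case: ifP.
Qed.

(** The value at which the descent along the Sturm sequence ends, its last
    remainder being zero. *)
Lemma cauchy_index0 (R : rcfType) (a b : R) (F : {poly R}) :
  cauchy_index a b 0 F = 0.
Proof.
rewrite /cauchy_index ind_plus0 ind_minus0 subr0 add0r big1 // => x _.
by rewrite /ind ind_plus0 ind_minus0 subr0.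
Qed.

Lemma cauchy_indexN (R : rcfType) (a b : R) (G F : {poly R}) : F != 0 ->
  cauchy_index a b (- G) F = - cauchy_index a b G F.
Proof.
move=> nF; have [-> | nG] := eqVneq G 0.
  by rewrite oppr0 cauchy_index0 oppr0.
have nNG : - G != 0 by rewrite oppr_eq0.
have P x : ind_plus x (- G) F = - ind_plus x G F.
  rewrite !ind_plusE // mu_opp mulNr -scaleN1r sgp_right_scale sgrN1 mulN1r.
  by rewrite mulNrn mulrN.
have M x : ind_minus x (- G) F = - ind_minus x G F.
  rewrite !ind_minusE // mulNr !mu_opp -scaleN1r sgp_right_scale sgrN1 mulN1r.
  by rewrite mulrN mulNrn mulrN.
rewrite /cauchy_index P M !opprD; congr (_ + _ + _); rewrite -sumrN.
by apply: eq_bigr => x _; rewrite /ind P M opprD.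
Qed.

(** * Telescoping of signs *)

(** Without roots in between, the right sign at a and the left sign at b are
    both the sign at the midpoint; the left sign is the right sign corrected by
    the parity of the multiplicity. *)
Lemma sgp_right_left (R : rcfType) (a b : R) (H : {poly R}) : a < b ->
  {in `]a, b[, forall x, ~~ root H x} ->
  sgp_right H a = (-1) ^+ \mu_b H * sgp_right H b.
Proof.
move=> ltab noH; pose y := (a + b) / 2.
have yab : y \in `]a, b[ by rewrite in_itv /= !midf_lt.
have nH : H != 0.
  by apply: contraNneq (noH y yab) => ->; rewrite root0.
rewrite -(@sgr_neighpr _ b H a y); last first.
  rewrite /neighpr; case: next_rootP => [h|z _ Hz /noH|c _ -> _].
  - by rewrite h eqxx in nH.
  - by rewrite rootE Hz eqxx.
  by rewrite max_l // ltW.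
rewrite -signr_odd -(@sgr_neighpl _ a H b y) //.
rewrite /neighpl; case: prev_rootP => [h|z _ Hz /noH|c _ -> _].
- by rewrite h eqxx in nH.
- by rewrite rootE Hz eqxx.
by rewrite min_l // ltW.
Qed.

(** The list s may contain points that are not roots of H, but it must contain
    all the roots: between two consecutive points H then has constant sign and
    the sum telescopes.  The induction moves the left end a along s. *)
Lemma sum_sign_jumps (R : rcfType) (b : R) (H : {poly R}) (s : seq R) (a : R) :
  path <%R a s -> last a s < b ->
  {in `]a, b[, forall x, root H x -> x \in s} ->
  sgp_right H a
    + \sum_(x <- s) (sgp_right H x - (-1) ^+ \mu_x H * sgp_right H x)
  = (-1) ^+ \mu_b H * sgp_right H b.
Proof.
elim: s a => [|c s IHs] a /=.
  move=> _ ltab noH; rewrite big_nil addr0; apply: sgp_right_left => // x xab.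
  by apply/negP => /(noH x xab).
case/andP=> ltac ps ltb Hs; rewrite big_cons.
have leclast : c <= last c s.
  move: (mem_last c s); rewrite inE => /orP[/eqP-> //|/= lin].
  by move/allP: (order_path_min lt_trans ps) => /(_ _ lin)/ltW.
have ltcb : c < b := le_lt_trans leclast ltb.
rewrite (@sgp_right_left _ a c) //; last first.
  move=> x xac; apply/negP => Hx.
  have /Hs/(_ Hx) : x \in `]a, b[.
    by move: xac; rewrite !in_itv /= => /andP[-> /lt_trans-> //].
  rewrite inE => /orP[/eqP ex|xs].
    by move: xac; rewrite ex in_itv /= ltxx andbF.
  move: (order_path_min lt_trans ps) => /allP/(_ x xs).
  by move: xac; rewrite in_itv /= => /andP[_ /lt_trans h] /h; rewrite ltxx.
rewrite addrA addrCA addrA addrK; apply: IHs => // x xcb Hx.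
have /Hs/(_ Hx) : x \in `]a, b[.
  by move: xcb; rewrite !in_itv /= => /andP[/(lt_trans ltac)-> ->].
rewrite inE => /orP[/eqP ex|//].
by move: xcb; rewrite ex in_itv /= ltxx.
Qed.

(** * Inversion and reduction of the Cauchy index *)

(** Allows the sums for G / F and F / G, indexed by the roots of F and by those
    of G, to be merged into one over the roots of G * F. *)
Lemma sum_indE (R : rcfType) (a b : R) (G F H : {poly R}) :
  F != 0 -> H != 0 -> F %| H ->
  \sum_(x <- roots F a b) ind x G F = \sum_(x <- roots H a b) ind x G F.
Proof.
move=> nF nH dFH; rewrite [RHS](bigID (root F)) /= [X in _ + X]big1 ?addr0.
  rewrite -[RHS]big_filter; apply: perm_big; apply: uniq_perm.
  - exact: uniq_roots.
  - exact/filter_uniq/uniq_roots.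
  move=> x; rewrite mem_filter !in_roots nF nH !andbT.
  case Fx: (root F x) => //=.
  by rewrite (root_dvdp dFH Fx).
by move=> x; apply: indNroot.
Qed.

(** G * F has the sign of both G / F and F / G, and exactly one of the strict
    inequalities and the equality between the multiplicities holds. *)
Lemma ind_plus_inv (R : rcfType) (x : R) (G F : {poly R}) : F != 0 -> G != 0 ->
  ind_plus x G F + ind_plus x F G
  = 2^-1 * (sgp_right (G * F) x - sign_ratio G F x).
Proof.
move=> nF nG; rewrite !ind_plusE // sign_ratioE // -mulrDr [F * G]mulrC.
by case: ltngtP => _; rewrite ?mulr1n ?mulr0n ?subrr ?subr0 ?addr0 ?add0r.
Qed.

Lemma ind_minus_inv (R : rcfType) (x : R) (G F : {poly R}) : F != 0 -> G != 0 ->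
  ind_minus x G F + ind_minus x F G
  = 2^-1 * ((-1) ^+ \mu_x (G * F) * sgp_right (G * F) x - sign_ratio G F x).
Proof.
move=> nF nG; rewrite !ind_minusE // sign_ratioE // -mulrDr [F * G]mulrC.
rewrite mu_mul ?mulf_neq0 //.
case: ltngtP => [_|_|->]; rewrite ?mulr1n ?mulr0n ?subr0 ?addr0 ?add0r //.
by rewrite -signr_odd addnn odd_double mul1r subrr.
Qed.

(** The inversion formula: adding the local identities, the right and left signs
    of G * F cancel along the interval. *)
Lemma cauchy_index_inv (R : rcfType) (a b : R) (G F : {poly R}) :
  a < b -> F != 0 -> G != 0 ->
  cauchy_index a b G F + cauchy_index a b F G
  = 2^-1 * (sign_ratio G F b - sign_ratio G F a).
Proof.
move=> ltab nF nG; have nH : G * F != 0 by rewrite mulf_neq0.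
rewrite /cauchy_index (sum_indE _ _ _ nF nH) ?dvdp_mulIr //.
rewrite (sum_indE _ _ _ nG nH) ?dvdp_mulIl //.
rewrite addrACA -opprD ind_minus_inv // addrACA ind_plus_inv // -big_split /=.
under eq_bigr => x _.
  rewrite /ind addrACA -opprD ind_minus_inv // ind_plus_inv // -mulrBr.
  rewrite opprB addrA subrK.
  over.
rewrite -mulr_sumr -(sum_sign_jumps (b := b) (a := a) (s := roots (G * F) a b)).
- by rewrite -!mulrDr -mulrBr; congr (_ * _); ring.
- exact: path_roots.
- exact: last_roots_le.
by move=> x xab Hx; rewrite in_roots Hx xab nH.
Qed.

(** Adding a polynomial multiple of G to F changes neither the poles of F / G
    nor its sign next to them: at a pole the multiplicity of F is smaller than
    that of the multiple of G, so F and F mod G have the same multiplicity and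
    the same right sign. *)
Lemma cauchy_index_mod (R : rcfType) (a b : R) (F G : {poly R}) : G != 0 ->
  cauchy_index a b F G = cauchy_index a b (F %% G) G.
Proof.
move=> nG; have [-> | nF] := eqVneq F 0; first by rewrite mod0p.
have [r0 | nr] := eqVneq (F %% G) 0.
  have mu x : (\mu_x F < \mu_x G)%N = false.
    rewrite (divp_eq F G) r0 addr0 mu_mul ?ltnNge ?leq_addl //.
    by move: nF; rewrite {1}(divp_eq F G) r0 addr0.
  have P x : ind_plus x F G = 0 by rewrite ind_plusE // mu mulr0.
  have M x : ind_minus x F G = 0 by rewrite ind_minusE // mu mulr0.
  rewrite r0 cauchy_index0 /cauchy_index P M subr0 add0r big1 // => x _.
  by rewrite /ind P M subr0.
(* F / G and (F mod G) / G have the same poles, with the same local data. *)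
have key x : (\mu_x F < \mu_x G)%N = (\mu_x (F %% G)%R < \mu_x G)%N /\
    ((\mu_x F < \mu_x G)%N -> \mu_x (F %% G) = \mu_x F /\
      sgp_right (F %% G) x = sgp_right F x).
  have [q0 | nq] := eqVneq (F %/ G * G) 0.
    have e : F %% G = F by rewrite [RHS](divp_eq F G) q0 add0r.
    by rewrite !e.
  have leq : (\mu_x G <= \mu_x (F %/ G * G)%R)%N by rewrite mu_mul // leq_addl.
  have eF : F = F %/ G * G + F %% G := divp_eq F G.
  have lt1 : (\mu_x (F %% G)%R < \mu_x G)%N ->
      \mu_x (F %% G) = \mu_x F /\ sgp_right (F %% G) x = sgp_right F x.
    move=> lt; have lt' := leq_trans lt leq.
    by rewrite [in \mu_x F]eF [in sgp_right F x]eF mu_addl // sgp_right_addp0.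
  have lt2 : (\mu_x F < \mu_x G)%N ->
      \mu_x (F %% G) = \mu_x F /\ sgp_right (F %% G) x = sgp_right F x.
    move=> lt; have lt' := leq_trans lt leq.
    have -> : F %% G = - (F %/ G * G) + F by rewrite [X in _ = _ + X]eF addKr.
    by rewrite mu_addl ?mu_opp // sgp_right_addp0 ?mu_opp.
  split=> //; apply/idP/idP => lt; first by have [-> _] := lt2 lt.
  by have [<- _] := lt1 lt.
have P x : ind_plus x F G = ind_plus x (F %% G) G.
  rewrite !ind_plusE //; have [<- h] := key x; case: (_ < _)%N h => //=.
  by move=> /(_ isT)[_ e]; rewrite !sgp_right_mul e.
have M x : ind_minus x F G = ind_minus x (F %% G) G.
  rewrite !ind_minusE //; have [<- h] := key x; case: (_ < _)%N h => //=.
  by move=> /(_ isT)[e' e]; rewrite !sgp_right_mul e !mu_mul ?mulf_neq0 // e'.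
rewrite /cauchy_index P M; congr (_ + _ - _); apply: eq_bigr => x _.
by rewrite /ind P M.
Qed.

(** * Determinants of Sylvester type *)

(** The determinant of n polynomials r 0, ..., r n.-1 whose rows list the top
    n.-1 coefficients, from degree n.-1 + j down to j + 1, followed by the
    polynomial itself.  Keeping n, j and the family of polynomials as separate
    arguments allows rows to be permuted and combined without casting matrix
    dimensions. *)
Definition coef_det (R : comNzRingType) (n j : nat) (r : nat -> {poly R}) :
    {poly R} :=
  \det (\matrix_(i < n, k < n)
    if (k < n.-1)%N then ((r i)`_(n.-1 + j - k))%:P else r i).

(** Here m1 and m2 are the numbers of multiples of P and of Q.  They are
    independent of the actual degrees of P and Q, since the reduction of P
    modulo Q lowers the degree of P and keeps the number of rows. *)
Definition sylv_row (R : comNzRingType) (m1 m2 : nat) (P Q : {poly R}) (i : nat)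
    : {poly R} :=
  if (i < m1)%N then 'X^(m1.-1 - i) * P else 'X^(i - m1) * Q.

Definition sylv_det (R : comNzRingType) (m1 m2 j : nat) (P Q : {poly R}) :
    {poly R} :=
  coef_det (m1 + m2) j (sylv_row m1 m2 P Q).

Lemma eq_coef_det (R : comNzRingType) (n j : nat) (r r' : nat -> {poly R}) :
  (forall i, (i < n)%N -> r i = r' i) -> coef_det n j r = coef_det n j r'.
Proof. by move=> e; congr (\det _); apply/matrixP => i k; rewrite !mxE e. Qed.

(** The rows depend linearly on the polynomials, so combining the polynomials by
    U multiplies the matrix by U on the left. *)
Lemma coef_det_mul (R : comNzRingType) (n j : nat) (U : 'M[R]_n)
    (r r' : nat -> {poly R}) :
  (forall i : 'I_n, r i = \sum_l U i l *: r' l) ->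
  coef_det n j r = \det U *: coef_det n j r'.
Proof.
move=> e; rewrite -mul_polyC -det_map_mx -det_mulmx; congr (\det _).
apply/matrixP => i k; rewrite !mxE e; case: ifP => kn.
  rewrite coef_sum rmorph_sum; apply: eq_bigr => l _.
  by rewrite !mxE kn coefZ /= polyCM.
by apply: eq_bigr => l _; rewrite !mxE kn mul_polyC.
Qed.

(** Reversing n + 1 items sends the first to the last place, a sign of n, and
    reverses the other n. *)
Lemma odd_rev_perm (n : nat) :
  odd_perm (perm (@rev_ord_inj n)) = odd 'C(n, 2).
Proof.
elim: n => [|n IHn].
  rewrite (_ : perm _ = 1%g) ?odd_perm1 //.
  by apply/permP => -[].
have -> : perm (@rev_ord_inj n.+1)
    = lift_perm ord0 ord_max (perm (@rev_ord_inj n)).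
  apply/permP => i; rewrite permE.
  have [->|[k ->]] : i = ord0 \/ exists k, i = lift ord0 k.
    by case: (unliftP ord0 i) => [k ->|->]; [right; exists k | left].
    by rewrite lift_perm_id; apply: val_inj; rewrite /= subn1.
  rewrite lift_perm_lift permE; apply: val_inj => /=.
  by rewrite /bump leq0n /=; have := ltn_ord k; case: leqP; lia.
by rewrite odd_lift_perm /= IHn binS bin1 oddD addbC.
Qed.

Lemma coef_det_rev (R : comNzRingType) (n j : nat) (r : nat -> {poly R}) :
  coef_det n j (fun i => r (n.-1 - i)%N) = (-1) ^+ 'C(n, 2) *: coef_det n j r.
Proof.
rewrite -(signr_odd _ 'C(n, 2)) -odd_rev_perm -det_perm.
apply: coef_det_mul => i; rewrite (bigD1 (rev_ord i)) //= big1 => [|l nl].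
  rewrite !mxE permE eqxx scale1r addr0; congr r.
  by case: n i => [[]|n] i //=; lia.
by rewrite !mxE permE eq_sym (negPf nl) scale0r.
Qed.

Lemma sylv_det_swap (R : comNzRingType) (m1 m2 j : nat) (P Q : {poly R}) :
  sylv_det m1 m2 j P Q
  = (-1) ^+ 'C(m1 + m2, 2) *: sylv_det m2 m1 j Q P.
Proof.
rewrite /sylv_det [(m2 + m1)%N]addnC -coef_det_rev; apply: eq_coef_det => i lti.
rewrite /sylv_row; case: ltnP => h1; case: ltnP => h2; try lia;
  by congr ('X^_ * _); lia.
Qed.

(** The rows of the first block are a times the rows of P plus combinations of
    the rows of Q; the degree bound on C is what keeps these combinations within
    the m2 available multiples of Q. *)
Lemma sylv_det_reduce (R : comNzRingType) (m1 m2 j : nat) (a : R)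
    (C P Q : {poly R}) : (size C <= (m2 - m1).+1)%N -> (m1 <= m2)%N ->
  sylv_det m1 m2 j (C * Q + a *: P) Q = a ^+ m1 *: sylv_det m1 m2 j P Q.
Proof.
move=> sC le12.
(* The upper right block expresses 'X^(m1.-1 - i) * C * Q by the rows of Q. *)
pose U : 'M[R]_(m1 + m2) := block_mx a%:M
  (\matrix_(i < m1, k < m2) ('X^(m1.-1 - i) * C)`_k) 0 1%:M.
have <- : \det U = a ^+ m1 by rewrite det_ublock det_scalar det1 mulr1.
apply: coef_det_mul => i; rewrite big_split_ord /=.
case: (splitP i) => i' ei; rewrite /sylv_row.
  have {ei} -> : i = lshift m2 i' by apply: val_inj.
  rewrite /= ltn_ord.
  rewrite (bigD1 i') //= big1 ?addr0 => [|l nl]; last first.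
    by rewrite block_mxEul !mxE eq_sym (negPf nl) scale0r.
  rewrite block_mxEul !mxE eqxx mulr1n ltn_ord scalerAr mulrDr addrC.
  congr (_ + _); rewrite mulrA.
  have s : (size ('X^(m1.-1 - i') * C)%R <= m2)%N.
    have [->|nC] := eqVneq C 0; first by rewrite mulr0 size_poly0.
    by rewrite mulrC size_mulXn //; have := ltn_ord i'; lia.
  rewrite -{1}(take_poly_id s) /take_poly poly_def mulr_suml.
  apply: eq_bigr => k _; rewrite block_mxEur !mxE /= -scalerAl.
  by rewrite ltnNge leq_addr addKn.
have {ei} -> : i = rshift m1 i' by apply: val_inj.
rewrite /= ltnNge leq_addr /= big1 ?add0r => [|l _]; last first.
  by rewrite block_mxEdl !mxE scale0r.
rewrite (bigD1 i') //= big1 ?addr0 => [|l nl]; last first.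
  by rewrite block_mxEdr !mxE eq_sym (negPf nl) scale0r.
by rewrite block_mxEdr !mxE eqxx scale1r ltnNge leq_addr.
Qed.

(** When Q has degree less than expected, the first column has a single nonzero
    entry, the coefficient of degree m2 + j of P in the first row; expanding
    along it removes that row.  The polynomial column is not the first one
    because m2 is positive. *)
Lemma sylv_det_lower (R : comNzRingType) (m1 m2 j k : nat) (P Q : {poly R}) :
  (0 < m2)%N -> (size P <= (m2 + j).+1)%N -> (size Q <= (m1 + j).+1)%N ->
  sylv_det (m1 + k) m2 j P Q = P`_(m2 + j) ^+ k *: sylv_det m1 m2 j P Q.
Proof.
move=> m2gt0 sP sQ; elim: k => [|k IHk]; first by rewrite addn0 scale1r.
rewrite addnS exprS -scalerA -IHk; set m := (m1 + k)%N.
have -> : sylv_det m.+1 m2 j P Q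
    = coef_det (m + m2).+1 j (sylv_row m.+1 m2 P Q) by [].
have lead i : (i < (m + m2).+1)%N -> (sylv_row m.+1 m2 P Q i)`_(m + m2 + j)
    = if i == 0%N then P`_(m2 + j) else 0.
  move=> lti; rewrite /sylv_row; case: (ltnP i m.+1) => him; rewrite coefXnM.
    case: i lti him => [|i] lti him /=.
      by rewrite subn0 ifF; [congr P`_ _; lia | lia].
    by rewrite ifF; [rewrite nth_default // (leq_trans sP) //; lia | lia].
  have -> : (i == 0%N) = false by lia.
  case: ltnP => // h; rewrite nth_default // (leq_trans sQ) //; lia.
rewrite /coef_det (expand_det_col _ ord0) (bigD1 ord0) //= big1 => [|i ni].
  rewrite addr0 !mxE /= addn_gt0 m2gt0 orbT subn0 lead //= mul_polyC.
  congr (_ *: _); rewrite /cofactor addn0 expr0 mul1r; congr (\det _).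
  apply/matrixP => i l; rewrite !mxE /= /bump !leq0n /= !add1n.
  have -> : sylv_row m.+1 m2 P Q i.+1 = sylv_row m m2 P Q i.
    rewrite /sylv_row ltnS /=; case: ltnP => h; last by rewrite subSS.
    by congr ('X^_ * _); lia.
  have -> : (l.+1 < m + m2)%N = (l < (m + m2).-1)%N by lia.
  case: ifP => // h; congr (_`_ _)%:P; lia.
rewrite !mxE /= addn_gt0 m2gt0 orbT subn0 lead //.
by rewrite -[_ == 0%N]/(i == ord0) (negPf ni) mul0r.
Qed.

(** * Subresultants along the Sturm sequence *)

Lemma odd_bin2D (m n : nat) : odd 'C(m + n, 2) =
  odd 'C(m, 2) (+) odd 'C(n, 2) (+) (odd m && odd n).
Proof.
elim: n => [|n IHn]; first by rewrite addn0 andbF !addbF.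
rewrite addnS !binS !bin1 !oddD IHn /=.
by case: (odd m); case: (odd n); case: (odd _); case: (odd _).
Qed.

(** One division step.  Allowing any bound r on the degree of the remainder,
    rather than its degree, also covers j = q - 1, where r = j and the new
    determinant is the remainder itself. *)
Lemma sylv_det_step (F : fieldType) (P Q : {poly F}) (p q r j : nat) :
  size P = p.+1 -> size Q = q.+1 -> (size (P %% Q)%R <= r.+1)%N ->
  (j <= r)%N -> (r < q)%N -> (q <= p)%N ->
  sylv_det (q - j) (p - j) j P Q
  = ((-1) ^+ 'C(p - q, 2) * lead_coef Q ^+ (p - r))
    *: sylv_det (r - j) (q - j) j Q (- (P %% Q)).
Proof.
move=> sP sQ sR jr rq qp.
(* The sign -1 of the new remainder is paid by each of the q - j rows of P. *)
rewrite {1}(divp_eq P Q) -[P %% Q in LHS]opprK -scaleN1r sylv_det_reduce.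
- rewrite sylv_det_swap (_ : (p - j = (r - j) + (p - r))%N); last by lia.
  rewrite sylv_det_lower ?size_polyN ?sQ; try lia.
  2: by rewrite (leq_trans sR) //; lia.
  rewrite !scalerA lead_coefE sQ subnK ?(leq_trans jr (ltnW rq)) //=.
  congr (_ * _ *: _); rewrite -exprD -[LHS]signr_odd -[RHS]signr_odd.
  congr (_ ^+ nat_of_bool _).
  have -> : (q - j + (r - j + (p - r)) = (p - q) + (q - j + (q - j)))%N by lia.
  rewrite oddD !odd_bin2D addnn odd_double andbF addbF.
  by case: (odd (q - j)); case: (odd 'C(q - j, 2)); case: (odd 'C(p - q, 2)).
- rewrite size_divp -?size_poly_gt0 ?sQ //= sP; lia.
by lia.
Qed.

Lemma size_sturm (F : fieldType) (P Q : {poly F}) (i : nat) :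
  sturm P Q i != 0 -> size (sturm P Q i) = (sturm_deg P Q i).+1.
Proof. by move=> nz; rewrite /sturm_deg /deg prednK // size_poly_gt0. Qed.

Lemma sturm_neq0 (F : fieldType) (P Q : {poly F}) (i : nat) :
  P != 0 -> (i <= sturm_len P Q)%N -> sturm P Q i != 0.
Proof.
case: i => // i nP; rewrite /sturm_len; case: ex_minnP => s _ min.
by apply: contraTneq => e; rewrite -ltnNge ltnS min // e.
Qed.

Lemma sturm_len_end (F : fieldType) (P Q : {poly F}) :
  sturm P Q (sturm_len P Q).+1 = 0.
Proof. by rewrite /sturm_len; case: ex_minnP => s /eqP. Qed.

Lemma sturm_deg_lt (F : fieldType) (P Q : {poly F}) (i : nat) :
  P != 0 -> (deg Q < deg P)%N -> (i < sturm_len P Q)%N ->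
  (sturm_deg P Q i.+1 < sturm_deg P Q i)%N.
Proof.
move=> nP ltQP; case: i => [//|i] lti.
rewrite -ltnS -!size_sturm ?sturm_neq0 //; last exact: ltnW.
by rewrite sturmS size_polyN ltn_modp sturm_neq0 // ltnW.
Qed.

(** The accumulated factor after i division steps: for j at most the degree of
    S_(i+1), the subresultant of index j of P and Q is this multiple of that of
    S_i and S_(i+1), by [sylv_det_sturm]. *)
Fixpoint sres_cofactor (F : fieldType) (P Q : {poly F}) (i : nat) : F :=
  if i is k.+1 then
    sres_cofactor P Q k
    * ((-1) ^+ 'C(sturm_deg P Q k - sturm_deg P Q k.+1, 2)
       * lead_coef (sturm P Q k.+1)
           ^+ (sturm_deg P Q k - sturm_deg P Q k.+2))
  else 1.

Lemma sylv_det_sturm (F : fieldType) (P Q : {poly F}) (i j : nat) :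
  P != 0 -> (deg Q < deg P)%N -> (i < sturm_len P Q)%N ->
  (j <= sturm_deg P Q i.+1)%N ->
  sylv_det (deg Q - j) (deg P - j) j P Q
  = sres_cofactor P Q i
    *: sylv_det (sturm_deg P Q i.+1 - j) (sturm_deg P Q i - j) j
         (sturm P Q i) (sturm P Q i.+1).
Proof.
move=> nP ltQP; elim: i => [|i IHi] lti jd; first by rewrite scale1r.
have lt1 := sturm_deg_lt nP ltQP (ltnW lti).
have lt2 := sturm_deg_lt nP ltQP lti.
rewrite (IHi (ltnW lti) (leq_trans jd (ltnW lt2))) -[RHS]scalerA.
congr (_ *: _).
have nz k : (k <= i.+2)%N -> sturm P Q k != 0.
  by move=> h; rewrite sturm_neq0 // (leq_trans h).
rewrite [in RHS]sturmS; apply: sylv_det_step => //.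
- by rewrite size_sturm // nz // leqW.
- by rewrite size_sturm // nz.
- by rewrite -size_polyN -sturmS size_sturm // nz.
by rewrite ltnW.
Qed.

(** The constant c_i with T_i = c_i S_i.  For i >= 2 the last division step is
    performed with formal remainder degree d_(i-1) - 1, hence the exponent. *)
Definition sres_coef (F : fieldType) (P Q : {poly F}) (i : nat) : F :=
  if i is k.+2 then
    sres_cofactor P Q k
    * ((-1) ^+ 'C(sturm_deg P Q k - sturm_deg P Q k.+1, 2)
       * lead_coef (sturm P Q k.+1)
           ^+ (sturm_deg P Q k - sturm_deg P Q k.+1).+1)
  else 1.

Lemma sres_mxE (F : fieldType) (P Q : {poly F}) (j : nat) :
  (j <= deg Q)%N -> (j <= deg P)%N ->
  \det (sres_mx P Q j) = sylv_det (deg Q - j) (deg P - j) j P Q.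
Proof.
move=> jQ jP; rewrite /sylv_det.
rewrite (_ : (deg Q - j + (deg P - j) = deg P + deg Q - j.*2)%N); last by lia.
congr (\det _); apply/matrixP => i k; rewrite !mxE subn1.
have -> : sres_row P Q j i = sylv_row (deg Q - j) (deg P - j) P Q i.
  by rewrite /sres_row /sylv_row subn1.
by case: ifP => // h; congr (_`_ _)%:P; lia.
Qed.

Lemma sylv_det01 (R : comNzRingType) (j : nat) (P Q : {poly R}) :
  sylv_det 0 1 j P Q = Q.
Proof. by rewrite /sylv_det /coef_det det_mx11 !mxE /sylv_row /= mul1r. Qed.

(** A form of the structure theorem of subresultants: T_(k+2) is reached from
    S_k and S_(k+1) by one more division step, which leaves a determinant with
    the single entry S_(k+2). *)
Lemma sresT_sturm (F : fieldType) (P Q : {poly F}) (i : nat) :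
  P != 0 -> (deg Q < deg P)%N -> (i <= sturm_len P Q)%N ->
  sresT P Q i = sres_coef P Q i *: sturm P Q i.
Proof.
move=> nP ltQP; case: i => [|[|i]] lti; rewrite ?scale1r //.
  rewrite /= /sresP /sturm_deg sturm0 subn1.
  case: ifP => h; last first.
    by rewrite eqxx ifF //; lia.
  rewrite sres_mxE //; last exact: leq_pred.
  have eQ : deg Q = (deg P).-1 by lia.
  by rewrite eQ subnn (_ : (deg P - _ = 1)%N) ?sylv_det01 //; lia.
have lt1 := sturm_deg_lt nP ltQP (ltnW lti).
have lt2 := sturm_deg_lt nP ltQP lti.
have nz k : (k <= i.+2)%N -> sturm P Q k != 0.
  by move=> h; rewrite sturm_neq0 // (leq_trans h).
have le1 : (sturm_deg P Q i.+1 <= deg Q)%N.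
  elim: i lti {lt1 lt2 nz} => [//|i IHi] lti.
  by rewrite (leq_trans _ (IHi (ltnW lti))) // ltnW // sturm_deg_lt // ltnW.
rewrite /= /sresP; have -> : (sturm_deg P Q i.+1 - 1 <= deg Q)%N by lia.
rewrite sres_mxE; try lia.
rewrite (sylv_det_sturm (i := i)) ?leq_subr // ?(ltnW lti) //.
rewrite (@sylv_det_step _ _ _ _ _ (sturm_deg P Q i.+1 - 1)); try lia.
- rewrite subnn subKn; last by lia.
  rewrite sylv_det01 -sturmS scalerA.
  by congr (_ * (_ * _ ^+ _) *: _); lia.
- by rewrite size_sturm // nz // leqW.
- by rewrite size_sturm // nz.
by rewrite -size_polyN -sturmS size_sturm ?nz //; lia.
Qed.

Lemma sturm_deg_ge (F : fieldType) (P Q : {poly F}) (i : nat) :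
  P != 0 -> (deg Q < deg P)%N -> (i < sturm_len P Q)%N ->
  (sturm_deg P Q i.+1 <= sturm_deg P Q i)%N.
Proof. by move=> *; rewrite ltnW // sturm_deg_lt. Qed.

(** * Signs of the proportionality constants *)

(** Adding 2 k to n adds k (2 n + 2 k - 1), of the parity of k, to
    n (n - 1) / 2. *)
Lemma eps_shift_even (F : fieldType) (n : int) (k : nat) :
  eps F (n + (k.*2)%:Z) = (-1) ^+ k * eps F n.
Proof.
rewrite /eps (_ : (n + (k.*2)%:Z) * (n + (k.*2)%:Z - 1)
  = (k%:Z * (2 * (n + k%:Z) - 1)) * 2 + n * (n - 1)); last first.
  by rewrite -muln2 PoszM; ring.
rewrite divzMDl // expfzDr ?oppr_eq0 ?oner_eq0 //; congr (_ * _).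
rewrite mulrBr mulr1 mulrCA expfzDr ?oppr_eq0 ?oner_eq0 //.
by rewrite -exprz_exp -exprnP sqrrN expr1n exp1rz mul1r -invr_expz invr_sign.
Qed.

Lemma epsE (F : fieldType) (n : nat) : eps F n%:Z = (-1) ^+ 'C(n, 2).
Proof.
rewrite /eps bin2 -divn2; case: n => [|n]; first by rewrite mul0r.
by rewrite -addn1 PoszD addrK -PoszM divz_nat addn1.
Qed.

Lemma odd_index0 (F : fieldType) (P Q : {poly F}) : odd_index P Q 0 = 0%N.
Proof.
by rewrite /odd_index big_mkcond big_ord_recr big_ord0 /= max0n; case: ifP.
Qed.

Lemma odd_indexS (F : fieldType) (P Q : {poly F}) (i : nat) :
  (sturm_deg P Q i.+1 <= sturm_deg P Q i)%N ->
  odd_index P Q i.+1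
  = if odd (sturm_deg P Q i - sturm_deg P Q i.+1) then i.+1
    else odd_index P Q i.
Proof.
move=> le; rewrite /odd_index big_mkcond big_ord_recr /= -big_mkcond /=.
rewrite distnEl //; case: ifP => _; last by rewrite maxn0.
by apply/maxn_idPr/bigmax_leqP => j _; apply: ltnW.
Qed.

(** The value 1 at index 0 mirrors the convention t_0 = 1 and makes
    [sres_coef_mul] uniform in i. *)
Definition sturm_lead (F : fieldType) (P Q : {poly F}) (i : nat) : F :=
  if i is 0%N then 1 else lead_coef (sturm P Q i).

Lemma srest_sturm (F : fieldType) (P Q : {poly F}) (i : nat) :
  P != 0 -> (deg Q < deg P)%N -> (i <= sturm_len P Q)%N ->
  srest P Q i = sres_coef P Q i * sturm_lead P Q i.
Proof.
case: i => [|i] nP ltQP lti; first by rewrite mulr1.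
by rewrite /srest sresT_sturm // lead_coefZ.
Qed.

Lemma sturm_lead_neq0 (F : fieldType) (P Q : {poly F}) (i : nat) :
  P != 0 -> (i <= sturm_len P Q)%N -> sturm_lead P Q i != 0.
Proof.
case: i => [|i] nP lti; first exact: oner_neq0.
by rewrite lead_coef_eq0 sturm_neq0.
Qed.

Lemma sres_cofactor_neq0 (F : fieldType) (P Q : {poly F}) (i : nat) :
  P != 0 -> (i <= sturm_len P Q)%N -> sres_cofactor P Q i != 0.
Proof.
move=> nP; elim: i => [|i IHi] lti; first exact: oner_neq0.
rewrite /= !mulf_neq0 ?IHi ?(ltnW lti) ?signr_eq0 //.
by rewrite expf_neq0 // lead_coef_eq0 sturm_neq0.
Qed.

Lemma sres_coef_neq0 (F : fieldType) (P Q : {poly F}) (i : nat) :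
  P != 0 -> (i <= sturm_len P Q)%N -> sres_coef P Q i != 0.
Proof.
case: i => [|[|i]] nP lti; try exact: oner_neq0.
rewrite /= !mulf_neq0 ?signr_eq0 ?sres_cofactor_neq0 ?(ltnW (ltnW lti)) //.
by rewrite expf_neq0 // lead_coef_eq0 sturm_neq0 // ltnW.
Qed.

Lemma sgr_sqr (R : realDomainType) (x : R) : x != 0 -> Num.sg x * Num.sg x = 1.
Proof. by move=> nx; rewrite -expr2 sqr_sg nx. Qed.

Lemma sgrX_odd (R : realDomainType) (x : R) (n : nat) : x != 0 ->
  Num.sg x ^+ n = if odd n then Num.sg x else 1.
Proof.
move=> nx; rewrite -[n in LHS]odd_double_half exprD -mul2n exprM.
by rewrite sqr_sg nx expr1n mulr1; case: (odd n).
Qed.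

(** The accumulated factors of c_(i+1) and c_(i+2) differ by one division step,
    so up to squares only the contributions of l_i and l_(i+1) and one sign
    remain. *)
Lemma sres_coef_mul (R : rcfType) (P Q : {poly R}) (i d : nat) :
  P != 0 -> (deg Q < deg P)%N -> (i.+1 < sturm_len P Q)%N ->
  d = (sturm_deg P Q i - sturm_deg P Q i.+1)%N ->
  Num.sg (sres_coef P Q i.+1) * Num.sg (sres_coef P Q i.+2)
  = (-1) ^+ 'C(d, 2) *
    (if odd d then 1
     else Num.sg (sturm_lead P Q i) * Num.sg (sturm_lead P Q i.+1)).
Proof.
move=> nP ltQP lti d_def; have lti' := ltnW lti; have lti'' := ltnW lti'.
have nl := sturm_lead_neq0 nP lti'.
have le1 := sturm_deg_ge nP ltQP lti'.
rewrite /= !sgrM !sgrX sgrN1.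
rewrite -[lead_coef (sturm _ _ i.+1)]/(sturm_lead P Q i.+1).
rewrite -d_def (sgrX_odd d.+1 nl) /=.
case: i => [|i] in lti lti' lti'' nl le1 d_def *.
  by rewrite sgr1 !mul1r; case: (odd d).
have nl' := sturm_lead_neq0 nP lti''.
have nc := sres_cofactor_neq0 nP (ltnW lti'').
have le0 := sturm_deg_ge nP ltQP lti''.
rewrite /= !sgrM !sgrX sgrN1.
rewrite -[lead_coef (sturm _ _ i.+1)]/(sturm_lead P Q i.+1).
set e := (sturm_deg P Q i - sturm_deg P Q i.+1)%N.
have -> : (sturm_deg P Q i - sturm_deg P Q i.+2)%N = (e + d)%N.
  by rewrite d_def /e; lia.
rewrite !sgrX_odd // oddS oddD.
have sq (A u v x y t : R) : A * A = 1 -> u * u = 1 ->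
    A * (u * x) * (A * (u * y) * (v * t)) = v * (x * y * t).
  move=> hA hu.
  transitivity (A * A * (u * u) * (v * (x * y * t))); first by ring.
  by rewrite hA hu !mul1r.
rewrite sq ?sgr_sqr // -?expr2 ?sqrr_sign //; congr (_ * _).
by case: (odd e); case: (odd d) => /=; rewrite ?mul1r ?mulr1 ?sgr_sqr.
Qed.

(** Let m be the last index with an odd degree drop.  In the induction step, if
    the drop at i + 1 is odd then m = i + 1 and both sides reduce to the same
    eps.  If it is even, m is unchanged, the signs eps multiply, and the
    induction hypothesis expresses the sign of t_m through l_i and c_(i+1). *)
Lemma sres_sign (R : rcfType) (P Q : {poly R}) (i : nat) :
  P != 0 -> (deg Q < deg P)%N -> (i < sturm_len P Q)%N ->
  eps R ((sturm_deg_pred P Q (odd_index P Q i))%:Z - (sturm_deg P Q i)%:Z)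
    * Num.sg (srest P Q (odd_index P Q i)) * Num.sg (srest P Q i)
  = Num.sg (sres_coef P Q i) * Num.sg (sres_coef P Q i.+1).
Proof.
move=> nP ltQP; elim: i => [|i IHi] lti.
  rewrite odd_index0 /= /sturm_deg sturm0 -addn1 PoszD addrAC subrr add0r.
  by rewrite epsE /= sgr1 !mulr1.
have lti' := ltnW lti; have := IHi lti'.
have le := sturm_deg_ge nP ltQP lti'.
set d := (sturm_deg P Q i - sturm_deg P Q i.+1)%N in le *.
rewrite (sres_coef_mul (d := d)) // odd_indexS // -/d.
case odd_d: (odd d) => IH.
  rewrite -[sturm_deg_pred _ _ _]/(sturm_deg P Q i) subzn // epsE -mulrA.
  rewrite sgr_sqr ?mulr1 //.
  rewrite srest_sturm ?mulf_neq0 ?sres_coef_neq0 ?sturm_lead_neq0 //.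
set m := odd_index P Q i in IH *.
have -> : (sturm_deg_pred P Q m)%:Z - (sturm_deg P Q i.+1)%:Z
    = (sturm_deg_pred P Q m)%:Z - (sturm_deg P Q i)%:Z + (d./2.*2)%:Z.
  have -> : d./2.*2 = d by rewrite -[RHS]odd_double_half odd_d.
  by rewrite /d -subzn //; ring.
rewrite eps_shift_even.
have -> : (-1) ^+ 'C(d, 2) = (-1) ^+ d./2 :> R.
  rewrite -epsE -[d in LHS]odd_double_half odd_d add0n.
  by rewrite -[_%:Z]add0r eps_shift_even epsE mulr1.
rewrite (srest_sturm (i := i.+1)) // ?(ltnW lti) //.
rewrite (srest_sturm (i := i)) // ?(ltnW lti') // in IH.
(* As c and l square to 1, the induction hypothesis determines e * t. *)
move: IH (sgr_sqr (sres_coef_neq0 nP (ltnW lti'))).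
move: (sgr_sqr (sturm_lead_neq0 nP (ltnW lti'))).
move: (sgr_sqr (sres_coef_neq0 nP lti')).
rewrite !sgrM; set c' := Num.sg (sres_coef P Q i.+1).
set c := Num.sg (sres_coef P Q i); set l := Num.sg (sturm_lead P Q i).
set l' := Num.sg (sturm_lead P Q i.+1); set t := Num.sg (srest P Q m).
move: (eps R _) ((-1) ^+ _) => e u c'c' ll IH cc.
have {IH} et : e * t = c' * l.
  transitivity (e * t * (c * l) * (c * l)).
    by transitivity (e * t * (c * c) * (l * l)); [rewrite cc ll !mulr1 | ring].
  by rewrite IH; transitivity (c * c * (c' * l)); [ring | rewrite cc mul1r].
transitivity (u * (e * t) * (c' * l')); first by ring.
rewrite et; transitivity (c' * c' * (u * (l * l'))); first by ring.
by rewrite c'c' mul1r.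
Qed.

(** * The Cauchy index from the Sturm sequence *)

Lemma sign_ratioZ (R : rcfType) (x c d : R) (G F : {poly R}) :
  c != 0 -> d != 0 -> F != 0 -> G != 0 ->
  sign_ratio (c *: G) (d *: F) x = Num.sg c * Num.sg d * sign_ratio G F x.
Proof.
move=> nc nd nF nG; rewrite !sign_ratioE ?scaler_eq0 ?negb_or ?nc ?nd //.
rewrite !mu_mulC // mulrnAr; congr (_ *+ _).
by rewrite -scalerAl -scalerAr scalerA sgp_right_scale sgrM.
Qed.

Lemma cauchy_index_sturm_step (R : rcfType) (a b : R) (P Q : {poly R})
    (i : nat) : a < b -> P != 0 -> (i < sturm_len P Q)%N ->
  cauchy_index a b (sturm P Q i.+1) (sturm P Q i)
  = 2^-1 * (sign_ratio (sturm P Q i.+1) (sturm P Q i) b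
            - sign_ratio (sturm P Q i.+1) (sturm P Q i) a)
    + cauchy_index a b (sturm P Q i.+2) (sturm P Q i.+1).
Proof.
move=> ltab nP lti; have n0 := sturm_neq0 nP (ltnW lti).
have n1 := sturm_neq0 nP lti.
rewrite sturmS cauchy_indexN // -cauchy_index_mod //.
by rewrite -cauchy_index_inv // addrK.
Qed.

(** The last term of the telescoping is the index of 0 / S_s, which vanishes. *)
Lemma cauchy_index_sturm (R : rcfType) (a b : R) (P Q : {poly R}) :
  a < b -> P != 0 -> Q != 0 ->
  cauchy_index a b Q P
  = 2^-1 * \sum_(0 <= i < sturm_len P Q)
      (sign_ratio (sturm P Q i.+1) (sturm P Q i) b
       - sign_ratio (sturm P Q i.+1) (sturm P Q i) a).
Proof.
move=> ltab nP nQ; rewrite mulr_sumr.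
have H k : (k <= sturm_len P Q)%N ->
    cauchy_index a b Q P = \sum_(0 <= i < k) 2^-1 *
      (sign_ratio (sturm P Q i.+1) (sturm P Q i) b
       - sign_ratio (sturm P Q i.+1) (sturm P Q i) a)
    + cauchy_index a b (sturm P Q k.+1) (sturm P Q k).
  elim: k => [|k IHk] ltk; first by rewrite big_nil add0r.
  rewrite (IHk (ltnW ltk)) big_nat_recr //=.
  by rewrite (cauchy_index_sturm_step ltab nP ltk) addrA.
by rewrite (H _ (leqnn _)) sturm_len_end cauchy_index0 addr0.
Qed.

Theorem theorem17 (R : rcfType) (a b : R) (P Q : {poly R})
    (ltab : a < b) (P_neq0 : P != 0) (Q_neq0 : Q != 0)
    (degP : (1 <= deg P)%N) (degQ : (deg Q < deg P)%N) :
  cauchy_index a b Q P =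
  2^-1 * \sum_(0 <= i < sturm_len P Q)
    eps R ((sturm_deg_pred P Q (odd_index P Q i))%:Z - (sturm_deg P Q i)%:Z)
    * Num.sg (srest P Q (odd_index P Q i)) * Num.sg (srest P Q i)
    * (sign_ratio (sresT P Q i.+1) (sresT P Q i) b
       - sign_ratio (sresT P Q i.+1) (sresT P Q i) a).
Proof.
rewrite (cauchy_index_sturm ltab P_neq0 Q_neq0); congr (_ * _).
apply: eq_big_nat => i /andP[_ lti].
have nc := sres_coef_neq0 P_neq0 (ltnW lti).
have nc' := sres_coef_neq0 P_neq0 lti.
have nS := sturm_neq0 P_neq0 (ltnW lti); have nS' := sturm_neq0 P_neq0 lti.
rewrite sres_sign // !sresT_sturm // ?(ltnW lti) //.
rewrite !sign_ratioZ // -mulrBr mulrA [Num.sg (sres_coef P Q i) * _]mulrC.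
by rewrite mulrACA !sgr_sqr // !mul1r.
Qed.
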